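(* A complemented subspace of the direct sum of an uncountable family of Banach spaces is isomorphic to a direct sum of $(\mathbf{LB})$-spaces. More formally: let $T$ be an uncountable set, let $B_t$, $t\in T$, be Banach spaces, and let $X$ be a complemented subspace of the direct sum $\bigoplus\{B_t\colon t\in T\}$. Then $X$ is isomorphic to a direct sum $\bigoplus\{F_j\colon j\in J\}$ of $(\mathbf{LB})$-spaces, where for each $j\in J$ the space $F_j$ is a complemented subspace of the countable direct sum $\bigoplus\{B_t\colon t\in T_j\}$ for some $T_j\subseteq T$ with $|T_j|=\omega$.
   Context: Spaces are over $\mathbb C$ and isomorphic means linearly homeomorphic. The (locally convex) direct sum $\bigoplus\{B_t\colon t\in T\}$ is the vector subspace of $\prod\{B_t\colon t\in T\}$ consisting of points with finitely many non-zero coordinates, endowed with the finest locally convex topology for which all natural embeddings $B_t\hookrightarrow\bigoplus\{B_t\colon t\in T\}$ are continuous. A subspace $F$ of a locally convex space $E$ is complemented if there is a continuous linear map $r\colon E\to F$ with $r(x)=x$ for all $x\in F$; ''$F$ is a complemented subspace of $E$'' is understood up to isomorphism. An $(\mathbf{LB})$-space is a Hausdorff locally convex space that is the locally convex inductive limit of a sequence of Banach spaces. *)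

(* Defs.v *)
From HB Require Import structures.
From mathcomp Require Import all_boot all_order all_algebra.
From mathcomp Require Import all_classical all_reals all_analysis.
From mathcomp Require Export complex.

Set Implicit Arguments.
Unset Strict Implicit.
Unset Printing Implicit Defensive.

Import Order.TTheory GRing.Theory Num.Theory.
Import numFieldNormedType.Exports.

Local Open Scope classical_set_scope.
Local Open Scope ring_scope.

(* In [tvsType] the relevant structure is the topology: local convexity is part
   of it, the Hausdorff property is not.  Over a complex field [convex_set]
   only uses coefficients 0 <= l <= 1, which are real. *)

(* A locally convex topology on the vector space underlying E is presented as a
   locally convex space F together with a linear bijection E -> F; it is coarser
   than the topology of E iff that bijection is continuous. *)
Definition finest_locally_convex (K : numFieldType) (E : tvsType K) (I : Type)
    (G : I -> tvsType K) (u : forall i, {linear G i -> E}) : Prop :=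
  (forall i, continuous (u i)) /\
  forall (F : tvsType K) (phi : {linear E -> F}), bijective phi ->
    (forall i, continuous (phi \o u i)) -> continuous phi.

Definition isomorphic (K : numFieldType) (E F : tvsType K) : Prop :=
  exists (f : {linear E -> F}) (g : {linear F -> E}),
    [/\ cancel f g, cancel g f, continuous f & continuous g].

Definition complemented (K : numFieldType) (E : tvsType K) (F : set E) : Prop :=
  exists r : {linear E -> E},
    [/\ continuous r, (forall x, F (r x)) & (forall x, F x -> r x = x)].

(* X is isomorphic to its image in E, with the subspace topology. *)
Definition linear_embedding (K : numFieldType) (X E : tvsType K)
    (f : {linear X -> E}) : Prop :=
  [/\ injective f, continuous f &
      forall U : set X, open U -> exists2 V : set E, open V & U = f @^-1` V].

(* "X is a complemented subspace of E", up to isomorphism. *)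
Definition complemented_subspace (K : numFieldType) (X E : tvsType K) : Prop :=
  exists2 f : {linear X -> E}, linear_embedding f & complemented (range f).

(* The B n are viewed as an increasing sequence of subspaces of E with union E,
   with continuous inclusions j n, the topology of E being the inductive one. *)
Definition LB_space (K : numFieldType) (E : tvsType K) : Prop :=
  hausdorff_space E /\
  exists (B : nat -> completeNormedModType K)
         (j : forall n, {linear B n -> B n.+1})
         (i : forall n, {linear B n -> E}),
    [/\ forall n, continuous (j n),
        forall n x, i n.+1 (j n x) = i n x,
        forall n, injective (i n),
        forall x, exists n, range (i n) x &
        finest_locally_convex i].

Section dsum_def.
Context (K : numFieldType) (I : Type) (E : I -> tvsType K).

Record dsum := DSum {
  dsum_fun :> forall t, E t ;
  dsum_finite : finite_set [set t | dsum_fun t != 0] }.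

Lemma dsumP (x y : dsum) : (forall t, x t = y t) -> x = y.
Proof.
case: x y => [f hf] [g hg] /= fg.
have e : f = g by apply: functional_extensionality_dep.
by subst g; congr DSum; exact: Prop_irrelevance.
Qed.

HB.instance Definition _ := gen_eqMixin dsum.
HB.instance Definition _ := gen_choiceMixin dsum.

Lemma dsum0_finite : finite_set [set t | (0 : E t) != 0].
Proof.
by rewrite (_ : mkset _ = set0)// -subset0 => t /=; rewrite eqxx.
Qed.

Lemma dsumD_finite (x y : dsum) : finite_set [set t | x t + y t != 0].
Proof.
apply: (sub_finite_set (B := [set t | x t != 0] `|` [set t | y t != 0])).
  move=> t /=; have [->|] := eqVneq (x t) 0; last by left.
  by rewrite add0r; right.
by rewrite finite_setU; split; exact: dsum_finite.
Qed.

Lemma dsumN_finite (x : dsum) : finite_set [set t | - x t != 0].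
Proof.
by apply: sub_finite_set (dsum_finite x) => t /=; rewrite oppr_eq0.
Qed.

Lemma dsumZ_finite (a : K) (x : dsum) : finite_set [set t | a *: x t != 0].
Proof.
by apply: sub_finite_set (dsum_finite x) => t /=; rewrite scaler_eq0 negb_or => /andP[].
Qed.

Definition dsum_zero := DSum dsum0_finite.
Definition dsum_add x y := DSum (dsumD_finite x y).
Definition dsum_opp x := DSum (dsumN_finite x).
Definition dsum_scale a x := DSum (dsumZ_finite a x).

Let addA : associative dsum_add.
Proof. by move=> x y z; apply: dsumP => t /=; rewrite addrA. Qed.
Let addC : commutative dsum_add.
Proof. by move=> x y; apply: dsumP => t /=; rewrite addrC. Qed.
Let add0 : left_id dsum_zero dsum_add.
Proof. by move=> x; apply: dsumP => t /=; rewrite add0r. Qed.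
Let addN : left_inverse dsum_zero dsum_opp dsum_add.
Proof. by move=> x; apply: dsumP => t /=; rewrite addNr. Qed.

HB.instance Definition _ := GRing.isZmodule.Build dsum addA addC add0 addN.

Let scaleA a b x : dsum_scale a (dsum_scale b x) = dsum_scale (a * b) x.
Proof. by apply: dsumP => t /=; rewrite scalerA. Qed.
Let scale1 : left_id 1 dsum_scale.
Proof. by move=> x; apply: dsumP => t /=; rewrite scale1r. Qed.
Let scaleDr : right_distributive dsum_scale +%R.
Proof. by move=> a x y; apply: dsumP => t /=; rewrite scalerDr. Qed.
Let scaleDl x : {morph dsum_scale^~ x : a b / a + b}.
Proof. by move=> a b; apply: dsumP => t /=; rewrite scalerDl. Qed.

HB.instance Definition _ :=
  GRing.Zmodule_isLmodule.Build K dsum scaleA scale1 scaleDr scaleDl.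

Lemma dsumDE (x y : dsum) t : (x + y) t = x t + y t. Proof. by []. Qed.
Lemma dsumZE a (x : dsum) t : (a *: x) t = a *: x t. Proof. by []. Qed.

Definition dsum_single t (v : E t) (s : I) : E s :=
  if pselect (t = s) is left e then eq_rect t (fun r => E r : Type) v s e else 0.

Lemma dsum_single_finite t (v : E t) : finite_set [set s | dsum_single v s != 0].
Proof.
apply: sub_finite_set (finite_set1 t) => s /=; rewrite /dsum_single.
by case: pselect => [e _|_]; [exact/esym|rewrite eqxx].
Qed.

Definition dsum_in t (v : E t) : dsum := DSum (dsum_single_finite v).

Lemma dsum_in_is_linear t : linear (@dsum_in t).
Proof.
move=> a v w; apply: dsumP => s; rewrite dsumDE dsumZE /= /dsum_single.
by case: pselect => [e|_]; [case: s / e | rewrite scaler0 addr0].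
Qed.

HB.instance Definition _ t :=
  GRing.isLinear.Build K (E t) dsum *:%R (@dsum_in t) (@dsum_in_is_linear t).

Lemma dsum_inE t (v : E t) : dsum_in v t = v.
Proof.
rewrite /= /dsum_single; case: pselect => [e|]; last by case.
by rewrite (Prop_irrelevance e erefl).
Qed.

Lemma dsum_inN t s (v : E t) : t <> s -> dsum_in v s = 0.
Proof. by move=> ts; rewrite /= /dsum_single; case: pselect. Qed.

(* The locally convex topologies on the vector space [dsum] are those induced by
   linear maps phi into locally convex spaces F.  The topology of the direct sum
   is the supremum of those for which all the embeddings are continuous (this
   family is directed, so that no finite intersections are needed below);
   [dsum_finest] states that it is the finest one. *)
Definition dsum_nbhs (x : dsum) : set_system dsum :=
  [set U | exists (F : tvsType K) (phi : {linear dsum -> F}),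
     (forall t, continuous (phi \o @dsum_in t)) /\
     exists2 V, nbhs (phi x) V & phi @^-1` V `<=` U].

HB.instance Definition _ := hasNbhs.Build dsum dsum_nbhs.

Lemma dsum_nbhs_filter (x : dsum) : ProperFilter (nbhs x).
Proof.
split.
  by move=> [F [phi [_ [V Vx V0]]]]; apply: (V0 x); exact: nbhs_singleton.
split.
- exists K^o, (\0 : {linear dsum -> K^o}); split.
    by move=> t; exact: cst_continuous.
  by exists setT => //; exact: filterT.
- move=> A B [F [phi [cphi [V Vx VA]]]] [G [psi [cpsi [W Wx WB]]]].
  pose h := fun z : dsum => (phi z, psi z) : (F * G)%type.
  have hl : linear h by move=> a y z; rewrite /h !linearP.
  pose hL : {linear dsum -> (F * G)%type} :=
    HB.pack h (GRing.isLinear.Build K dsum (F * G)%type *:%R h hl).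
  exists (F * G)%type, hL; split.
    by move=> t v; apply: cvg_pair; [exact: cphi|exact: cpsi].
  exists (V `*` W); first by exists (V, W).
  by move=> z [/= /VA ? /WB ?].
- move=> A B AB [F [phi [cphi [V Vx VA]]]]; exists F, phi; split=> //.
  by exists V => // z /VA /AB.
Qed.

Lemma dsum_nbhs_singleton (x : dsum) (A : set dsum) : nbhs x A -> A x.
Proof. by move=> [F [phi [_ [V Vx]]]]; apply; exact: nbhs_singleton. Qed.

Lemma dsum_nbhs_nbhs (x : dsum) (A : set dsum) : nbhs x A -> nbhs x (nbhs^~ A).
Proof.
move=> [F [phi [cphi [V Vx VA]]]]; exists F, phi; split=> //.
by exists (nbhs^~ V); [exact: nbhs_interior|move=> z Vz; exists F, phi; split=> //; exists V].
Qed.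

HB.instance Definition _ := Nbhs_isNbhsTopological.Build dsum
  dsum_nbhs_filter dsum_nbhs_singleton dsum_nbhs_nbhs.

Lemma dsum_initial (F : tvsType K) (phi : {linear dsum -> F}) :
  (forall t, continuous (phi \o @dsum_in t)) -> continuous phi.
Proof. by move=> cphi x V Vx; exists F, phi; split=> //; exists V. Qed.

Lemma dsum_add_continuous : continuous (fun z : dsum * dsum => z.1 + z.2).
Proof.
move=> [x y] U [F [phi [cphi [V]]]]; rewrite /= linearD => Vx VU.
have [[A B] [/= Ax By] AB] := @add_continuous F (phi x, phi y) V Vx.
exists (phi @^-1` A, phi @^-1` B).
  by split; [exact: (dsum_initial cphi Ax)|exact: (dsum_initial cphi By)].
move=> [a b] [/= Aa Bb]; apply: VU; rewrite /preimage/= linearD.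
exact: (AB (phi a, phi b)).
Qed.

Lemma dsum_scale_continuous : continuous (fun z : K^o * dsum => z.1 *: z.2).
Proof.
move=> [k x] U [F [phi [cphi [V]]]]; rewrite /= linearZ => Vx VU.
have [[A B] [/= Ak Bx] AB] := @scale_continuous K F (k, phi x) V Vx.
exists (A, phi @^-1` B); first by split => //; exact: (dsum_initial cphi Bx).
move=> [a b] [/= Aa Bb]; apply: VU; rewrite /preimage/= linearZ.
exact: (AB (a, phi b)).
Qed.

Lemma dsum_locally_convex : exists2 B : set_system dsum,
  (forall b, b \in B -> convex_set b) & basis B.
Proof.
exists [set b | open b /\ convex_set b]; first by move=> b /set_mem[].
split; first by move=> b [].
move=> x U [F [phi [cphi [V Vx VU]]]].
have [Bs Bc [Bo Bb]] := @locally_convex K F.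
have [W [BW Wx] WV] := Bb _ _ Vx.
exists (phi @^-1` W); last by move=> z /WV /VU.
split=> //; split.
  apply: open_comp; last exact: Bo.
  by move=> z _; exact: (dsum_initial cphi).
move=> y z l /set_mem Wy /set_mem Wz; apply/mem_set; rewrite /preimage/=.
have := Bc _ (mem_set BW) (phi y) (phi z) l (mem_set Wy) (mem_set Wz).
by move/set_mem; rewrite linearD !linearZ.
Qed.

(* [PreTopologicalLmod_isTvs] only builds the uniform structure. *)
HB.instance Definition _ :=
  PreTopologicalNmodule_isTopologicalNmodule.Build dsum dsum_add_continuous.
HB.instance Definition _ :=
  TopologicalNmodule_isTopologicalLmodule.Build K dsum dsum_scale_continuous.
HB.instance Definition _ := PreTopologicalLmod_isTvs.Build K dsum
  dsum_add_continuous dsum_scale_continuous dsum_locally_convex.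
HB.instance Definition _ := Uniform_isTvs.Build K dsum dsum_locally_convex.

Lemma dsum_in_continuous t : continuous (@dsum_in t).
Proof.
move=> v U [F [phi [cphi [V Vx VU]]]].
have h : nbhs v ((phi \o @dsum_in t) @^-1` V) := cphi t v V Vx.
by apply: filterS h => w; exact: VU.
Qed.

Lemma dsum_finest : finest_locally_convex (fun t => @dsum_in t).
Proof.
split; first exact: dsum_in_continuous.
by move=> F phi _; exact: dsum_initial.
Qed.

End dsum_def.

(* Main.v *)
Require Import Defs.
From HB Require Import structures.
From mathcomp Require Import all_boot all_order all_algebra.
From mathcomp Require Import all_classical all_reals all_analysis.
From mathcomp Require Import complex wochoice.

(** Let [E] be the direct sum of the [B t] and [r] a continuous projection of [E]
    onto a copy of [X].

    Weighted l1 norms [x |-> \sum_t c t * |x t|] are continuous on [E] for every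
    choice of weights.  Hence a continuous linear map from a normed space into
    [E] takes its values in a finite subsum ([normed_dsum_finite_support]):
    infinitely many coordinates in use would, with suitable weights, make the map
    unbounded.  In particular [r] sends every [B t] into a finite subsum, so the
    matrix of [r] has finite columns.

    Well-order [T], close each index under the relation given by these
    columns, and let [tau s] be the least index whose closure contains [s]
    ([countable_layering]).  The fibres of [tau] are countable, and [r] is
    block-triangular for [tau]: it never raises [tau].  Its block diagonal part
    [d] is again a projection, and it splits along the fibres of [tau], so its
    range is the direct sum of the ranges of the diagonal blocks of [r].

    The operator [u = r d + (1 - r) (1 - d)] satisfies [u d = r d = r u], and its
    block diagonal part is [d d + (1 - d) (1 - d) = 1].  So [1 - u] strictly
    lowers [tau]; its columns being finite, well-foundedness makes it nilpotent
    on each [B t] ([strictly_triangular_nil]), and the Neumann series, a finite sum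
    on each [B t], inverts [u] continuously ([unipotent_inverse]).  Conjugation by
    [u] turns [r] into [d] ([block_diagonalization]), whence [X] is isomorphic to
    the direct sum of the ranges of the diagonal blocks.

    Finally, the range of a continuous projection [p] of [E] with coordinates in a
    countable set [D] is an LB-space ([range_LB]): exhaust [D] by finite sets [S n];
    the elements of the range supported in [S n] form a closed subspace of a finite
    sum of Banach spaces, and [p] maps each [B t] into one of these pieces, which
    forces the topology to be the inductive one.  Uncountability of [T] serves to
    enlarge each fibre of [tau] to a set of cardinality exactly omega. *)

Set Implicit Arguments.
Unset Strict Implicit.
Unset Printing Implicit Defensive.

Import Order.TTheory GRing.Theory Num.Theory.
Import numFieldNormedType.Exports.

Local Open Scope classical_set_scope.
Local Open Scope ring_scope.

(** * Continuous linear maps and retracts *)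

Section continuity.
Context (K : numFieldType).

Lemma tvs_continuousD (S : topologicalType) (E : tvsType K) (f g : S -> E) :
  continuous f -> continuous g -> continuous (fun x => f x + g x).
Proof.
move=> cf cg x; apply: (@continuous_comp _ _ _ (fun x => (f x, g x))
  (fun z : E * E => z.1 + z.2)); last exact: add_continuous.
by apply: cvg_pair; [exact: cf|exact: cg].
Qed.

Lemma tvs_continuousB (S : topologicalType) (E : tvsType K) (f g : S -> E) :
  continuous f -> continuous g -> continuous (fun x => f x - g x).
Proof.
move=> cf cg x; apply: (@continuous_comp _ _ _ (fun x => (f x, g x))
  (fun z : E * E => z.1 - z.2)); last exact: sub_continuous.
by apply: cvg_pair; [exact: cf|exact: cg].
Qed.

Lemma tvs_cvg_sum (S : Type) (F : set_system S) (FF : Filter F) (E : tvsType K)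
    (I : Type) (s : seq I) (f : I -> S -> E) (l : I -> E) :
  (forall i, f i @ F --> l i) ->
  (fun x => \sum_(i <- s) f i x) @ F --> \sum_(i <- s) l i.
Proof.
move=> fl; elim: s => [|i s IHs].
  rewrite (_ : (fun x => _) = cst 0); first by rewrite big_nil; exact: cvg_cst.
  by apply/funext => x; rewrite big_nil.
rewrite big_cons.
rewrite (_ : (fun x => _) = (fun x => f i x + \sum_(i <- s) f i x)); last first.
  by apply/funext => x; rewrite big_cons.
apply: (@cvg_comp _ _ _ (fun x => (f i x, \sum_(i <- s) f i x))
  (fun z : E * E => z.1 + z.2) _ (nbhs (l i, \sum_(i <- s) l i))).
  exact: cvg_pair.
exact: (@add_continuous E (l i, \sum_(i <- s) l i)).
Qed.

Lemma tvs_continuous_sum (S : topologicalType) (E : tvsType K) (I : Type)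
    (s : seq I) (f : I -> S -> E) :
  (forall i, continuous (f i)) -> continuous (fun x => \sum_(i <- s) f i x).
Proof. by move=> cf x; apply: tvs_cvg_sum => i; exact: cf. Qed.

End continuity.

Section retract.
Context (K : numFieldType).

(** A complemented subspace up to isomorphism is the same thing as a retract in the
    category of continuous linear maps; the left inverse [g] is the projection
    followed by the inverse of the embedding. *)
Lemma complemented_subspace_retract (X E : tvsType K) :
  complemented_subspace X E ->
  exists (f : {linear X -> E}) (g : {linear E -> X}),
    [/\ continuous f, continuous g & cancel f g].
Proof.
move=> [f [finj fc fo] [r [rc rf rid]]].
have gP x : {y | f y = r x}.
  by apply: cid; have [y _ yE] := rf x; exists y.
pose g x := sval (gP x).
have fg x : f (g x) = r x by rewrite /g; case: (gP x).
have glin : linear g.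
  by move=> a x y; apply: finj; rewrite linearP !fg linearP.
pose gL : {linear E -> X} := HB.pack g (GRing.isLinear.Build K E X *:%R g glin).
exists f, gL; split => //.
  apply/continuousP => U /fo[V oV ->].
  rewrite (_ : _ @^-1` _ = r @^-1` V); first by move/continuousP: rc; exact.
  by apply/seteqP; split => x; rewrite /preimage/= fg.
by move=> x; apply: finj; rewrite /= fg rid//; exists x.
Qed.

Lemma retract_complemented_subspace (X E : tvsType K)
    (f : {linear X -> E}) (g : {linear E -> X}) :
  continuous f -> continuous g -> cancel f g -> complemented_subspace X E.
Proof.
move=> fc gc fK; exists f.
  split; [exact: can_inj fK|by []|move=> U oU].
  exists (g @^-1` U); first by move/continuousP: gc; exact.
  by apply/seteqP; split => x; rewrite /preimage/= fK.
exists (f \o g); split.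
- by move=> x; apply: continuous_comp; [exact: gc|exact: fc].
- by move=> x; exists (g x).
- by move=> _ [x _ <-] /=; rewrite fK.
Qed.

End retract.

Lemma infinite_set_sequence (T : Type) (A : set T) : infinite_set A ->
  exists2 b : nat -> T, injective b & forall n, A (b n).
Proof.
move=> /infiniteP/card_leP[a].
exists (fun n => val (a (exist _ n (mem_set Logic.I)))) => [m n|n].
  move=> /val_inj/(inj (f := a)).
  by move=> /(_ (mem_set Logic.I) (mem_set Logic.I)) [].
exact: set_mem (valP (a (exist _ n (mem_set Logic.I)))).
Qed.

Lemma finite_set_uniq_seq (T : choiceType) (S : set T) :
  finite_set S -> exists2 s : seq T, uniq s & forall t, S t <-> t \in s.
Proof.
move=> /finite_seqP[s ->]; exists (undup s); first exact: undup_uniq.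
by move=> t; rewrite mem_undup.
Qed.

(** * Coordinates and restrictions in direct sums *)

Section dsum_theory.
Context (K : numFieldType) (I : choiceType) (E : I -> tvsType K).
Implicit Types (x y : dsum E).

Definition dsum_coord t x : E t := x t.

Lemma dsum_coord_is_linear t : linear (dsum_coord t). Proof. by []. Qed.

HB.instance Definition _ t := GRing.isLinear.Build K (dsum E) (E t) *:%R
  (dsum_coord t) (@dsum_coord_is_linear t).

(** [dsum_in] with its linear structure bundled in.  When [E t] is the space
    underlying a normed space, the bundled map typechecks as a linear map on that
    normed space by conversion, whereas canonical structure inference would have
    to guess [E]. *)
Definition dsum_inL t : {linear E t -> dsum E} := @dsum_in K I E t.

Lemma dsum_sumE (J : Type) (s : seq J) (F : J -> dsum E) t :
  (\sum_(j <- s) F j) t = \sum_(j <- s) F j t.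
Proof. exact: (linear_sum (dsum_coord t)). Qed.

Lemma dsum0E t : (0 : dsum E) t = 0. Proof. by []. Qed.
Lemma dsumBE x y t : (x - y) t = x t - y t. Proof. by []. Qed.

Lemma dsum_seqE (s : seq I) x : uniq s ->
  (forall t, x t != 0 -> t \in s) -> x = \sum_(t <- s) dsum_in (x t).
Proof.
move=> us xs; apply: dsumP => t; rewrite dsum_sumE.
have [ts|tNs] := boolP (t \in s).
  rewrite (bigD1_seq t)//= -/(dsum_in _) -[X in _ = X + _]/(dsum_in (x t) t).
  rewrite dsum_inE big1 ?addr0// => r /eqP rt.
  exact: (@dsum_inN _ _ _ r t).
have /eqP xt0 : x t == 0 by apply: contraNT tNs; exact: xs.
rewrite xt0 big_seq big1// => r rs; apply: (@dsum_inN _ _ _ r t) => rt.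
by move: tNs; rewrite -rt rs.
Qed.

Lemma dsum_sumP x : exists2 s : seq I, (forall t, t \in s <-> x t != 0) &
  x = \sum_(t <- s) dsum_in (x t).
Proof.
have [s us sP] := finite_set_uniq_seq (dsum_finite x).
by exists s => [t|]; [rewrite -sP|apply: dsum_seqE => // t /sP].
Qed.

(** Properties closed under addition need only be checked on the summands [E t]
    that meet the support. *)
Lemma dsum_ind (P : dsum E -> Prop) (S : set I) x : P 0 ->
  (forall y z, P y -> P z -> P (y + z)) ->
  (forall t, S t -> forall v : E t, P (dsum_in (E:=E) v)) ->
  (forall t, x t != 0 -> S t) -> P x.
Proof.
move=> P0 PD Pin xS; have [s sx ->] := dsum_sumP x.
rewrite big_seq; elim/big_ind : _ => // t /sx/xS St; exact: Pin.
Qed.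

Lemma dsum_restr_finite (A : set I) x :
  finite_set [set t | (if t \in A then x t else 0) != 0].
Proof.
by apply: sub_finite_set (dsum_finite x) => t /=; case: ifPn => //; rewrite eqxx.
Qed.

Definition dsum_restr (A : set I) x := DSum (dsum_restr_finite A x).

Lemma dsum_restrE (A : set I) x t :
  dsum_restr A x t = if t \in A then x t else 0.
Proof. by []. Qed.

Lemma dsum_restr_is_linear A : linear (dsum_restr A).
Proof.
move=> a x y; apply: dsumP => t; rewrite dsumDE dsumZE !dsum_restrE.
by case: ifP => // _; rewrite scaler0 addr0.
Qed.

HB.instance Definition _ A := GRing.isLinear.Build K (dsum E) (dsum E) *:%R
  (dsum_restr A) (@dsum_restr_is_linear A).

Lemma dsum_restr_id A x : (forall t, x t != 0 -> A t) -> dsum_restr A x = x.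
Proof.
move=> xA; apply: dsumP => t; rewrite dsum_restrE; case: ifPn => //.
by rewrite notin_setE => At; apply/esym/eqP; apply: contra_notT At; exact: xA.
Qed.

Lemma dsum_restr0 A x : (forall t, x t != 0 -> ~ A t) -> dsum_restr A x = 0.
Proof.
move=> xA; apply: dsumP => t; rewrite dsum_restrE dsum0E; case: ifPn => //.
by rewrite inE => At; apply/eqP; apply: contraPT At; exact: xA.
Qed.

Lemma dsum_in_supp t (v : E t) s : dsum_in (E:=E) v s != 0 -> s = t.
Proof.
by move=> /eqP ts; apply: contrapT => st; apply: ts; apply: dsum_inN => /esym.
Qed.

Lemma dsum_restr_continuous A : continuous (dsum_restr A).
Proof.
apply: dsum_initial => t.
have [At|At] := pselect (A t).
  rewrite (_ : _ \o _ = @dsum_in _ _ E t); first exact: dsum_in_continuous.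
  by apply/funext => v; apply: dsum_restr_id => s /dsum_in_supp ->.
rewrite (_ : _ \o _ = cst 0); first exact: cst_continuous.
by apply/funext => v; apply: dsum_restr0 => s /dsum_in_supp ->.
Qed.

End dsum_theory.

Arguments dsum_inL {K I} E t.

(** * Kernels as locally convex spaces *)

Section linear_initial.
Context (K : numFieldType) (L : lmodType K) (E : tvsType K) (f : {linear L -> E}).

(** The pullback of a locally convex topology along a linear map is locally
    convex. *)
Definition linear_initial : Type := initial_topology f.

HB.instance Definition _ := Uniform.on linear_initial.
HB.instance Definition _ := GRing.Lmodule.copy linear_initial L.

Definition linear_initial_val (x : linear_initial) : E := f x.

Lemma linear_initial_val_is_linear : linear linear_initial_val.
Proof. exact: linearP. Qed.

HB.instance Definition _ := GRing.isLinear.Build K linear_initial E *:%R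
  linear_initial_val linear_initial_val_is_linear.

Lemma linear_initial_continuous : continuous linear_initial_val.
Proof. exact: initial_continuous. Qed.

Lemma linear_initial_universal (T : topologicalType) (g : T -> linear_initial) :
  continuous (linear_initial_val \o g) -> continuous g.
Proof.
move=> cfg; apply/continuousP => _ [U oU <-].
by have /continuousP/(_ U oU) := cfg.
Qed.

Lemma linear_initial_add_continuous :
  continuous (fun z : linear_initial * linear_initial => z.1 + z.2).
Proof.
apply: linear_initial_universal.
rewrite (_ : _ \o _ = fun z : linear_initial * linear_initial =>
    linear_initial_val z.1 + linear_initial_val z.2); last first.
  by apply/funext => z /=; rewrite linearD.
apply: tvs_continuousD => z; apply: continuous_comp.
- exact: cvg_fst.
- exact: linear_initial_continuous.
- exact: cvg_snd.
- exact: linear_initial_continuous.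
Qed.

Lemma linear_initial_scale_continuous :
  continuous (fun z : K^o * linear_initial => z.1 *: z.2).
Proof.
apply: linear_initial_universal.
rewrite (_ : _ \o _ = fun z : K^o * linear_initial =>
    z.1 *: linear_initial_val z.2); last first.
  by apply/funext => z /=; rewrite linearZ.
move=> z; apply: (@continuous_comp _ _ _ (fun z : K^o * linear_initial =>
  (z.1, linear_initial_val z.2)) (fun z : K^o * E => z.1 *: z.2)).
  apply: (@cvg_pair _ _ _ _ (nbhs (z.1 : K^o))); first exact: cvg_fst.
  by apply: continuous_comp; [exact: cvg_snd|exact: linear_initial_continuous].
exact: scale_continuous.
Qed.

Lemma linear_initial_locally_convex : exists2 B : set_system linear_initial,
  (forall b, b \in B -> convex_set b) & basis B.
Proof.
have [Bs Bc [Bo Bb]] := @locally_convex K E.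
exists [set linear_initial_val @^-1` b | b in Bs].
  move=> _ /set_mem[b Bsb <-] y z l /set_mem by_ /set_mem bz; apply/mem_set.
  have := Bc _ (mem_set Bsb) (f y) (f z) l (mem_set by_) (mem_set bz).
  by move/set_mem; rewrite /preimage/= linearD !linearZ.
split.
  move=> _ [b /Bo bo <-]; have /continuousP := linear_initial_continuous; exact.
move=> x U; rewrite nbhsE => -[_ [[V oV <-] Vx] VU].
have [W [BW Wx] WV] := Bb (f x) V (open_nbhs_nbhs (conj oV Vx)).
exists (linear_initial_val @^-1` W); first by split => //; exists W.
by move=> z Wz; apply: VU; exact: WV.
Qed.

HB.instance Definition _ :=
  PreTopologicalNmodule_isTopologicalNmodule.Build linear_initial
    linear_initial_add_continuous.
HB.instance Definition _ :=
  TopologicalNmodule_isTopologicalLmodule.Build K linear_initial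
    linear_initial_scale_continuous.
HB.instance Definition _ :=
  Uniform_isTvs.Build K linear_initial linear_initial_locally_convex.

End linear_initial.

Section lkernel.
Context (K : numFieldType) (V W : lmodType K) (h : {linear V -> W}).

(** Subspaces are presented as kernels; the range of a projection [p] is the kernel
    of [1 - p]. *)
Record lkernel := LKernel { lkernel_val : V ; lkernelP : h lkernel_val = 0 }.

Lemma lkernel_val_inj : injective lkernel_val.
Proof.
move=> [x hx] [y hy] /= xy; subst y; congr LKernel; exact: Prop_irrelevance.
Qed.

HB.instance Definition _ := gen_eqMixin lkernel.
HB.instance Definition _ := gen_choiceMixin lkernel.

Let addP (x y : lkernel) : h (lkernel_val x + lkernel_val y) = 0.
Proof. by rewrite linearD !lkernelP addr0. Qed.
Let oppP (x : lkernel) : h (- lkernel_val x) = 0.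
Proof. by rewrite linearN lkernelP oppr0. Qed.
Let scaleP a (x : lkernel) : h (a *: lkernel_val x) = 0.
Proof. by rewrite linearZ/= lkernelP scaler0. Qed.

Let zero := LKernel (linear0 h).
Let add x y := LKernel (addP x y).
Let opp x := LKernel (oppP x).
Let scale a x := LKernel (scaleP a x).

Let addA : associative add.
Proof. by move=> x y z; apply: lkernel_val_inj; rewrite /= addrA. Qed.
Let addC : commutative add.
Proof. by move=> x y; apply: lkernel_val_inj; rewrite /= addrC. Qed.
Let add0 : left_id zero add.
Proof. by move=> x; apply: lkernel_val_inj; rewrite /= add0r. Qed.
Let addN : left_inverse zero opp add.
Proof. by move=> x; apply: lkernel_val_inj; rewrite /= addNr. Qed.

HB.instance Definition _ := GRing.isZmodule.Build lkernel addA addC add0 addN.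

Let scaleA a b x : scale a (scale b x) = scale (a * b) x.
Proof. by apply: lkernel_val_inj; rewrite /= scalerA. Qed.
Let scale1 : left_id 1 scale.
Proof. by move=> x; apply: lkernel_val_inj; rewrite /= scale1r. Qed.
Let scaleDr : right_distributive scale +%R.
Proof. by move=> a x y; apply: lkernel_val_inj; rewrite /= scalerDr. Qed.
Let scaleDl x : {morph scale^~ x : a b / a + b}.
Proof. by move=> a b; apply: lkernel_val_inj; rewrite /= scalerDl. Qed.

HB.instance Definition _ :=
  GRing.Zmodule_isLmodule.Build K lkernel scaleA scale1 scaleDr scaleDl.

Lemma lkernel_val_is_linear : linear lkernel_val. Proof. by []. Qed.

HB.instance Definition _ :=
  GRing.isLinear.Build K lkernel V *:%R lkernel_val lkernel_val_is_linear.

End lkernel.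

Section kernel_tvs.
Context (K : numFieldType) (E : tvsType K) (W : lmodType K) (h : {linear E -> W}).

Definition kernel_tvs : tvsType K := linear_initial (@lkernel_val K E W h).

Definition kernel_val : {linear kernel_tvs -> E} :=
  linear_initial_val (f := @lkernel_val K E W h).

Lemma kernel_val_inj : injective kernel_val.
Proof. exact: lkernel_val_inj. Qed.

Lemma kernel_valP x : h (kernel_val x) = 0.
Proof. exact: (@lkernelP _ _ _ h x). Qed.

Lemma kernel_val_continuous : continuous kernel_val.
Proof. exact: linear_initial_continuous. Qed.

Lemma kernel_continuous (T : topologicalType) (g : T -> kernel_tvs) :
  continuous (kernel_val \o g) -> continuous g.
Proof. exact: linear_initial_universal. Qed.

(** The universal property of the kernel. *)
Lemma kernel_lift (V : lmodType K) (f : {linear V -> E}) :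
  (forall x, h (f x) = 0) ->
  {g : {linear V -> kernel_tvs} | forall x, kernel_val (g x) = f x}.
Proof.
move=> hf; pose g x : kernel_tvs := LKernel (hf x).
have glin : linear g by move=> a x y; apply: kernel_val_inj; exact: (linearP f).
pose gL : {linear V -> kernel_tvs} := HB.pack g
  (GRing.isLinear.Build K V kernel_tvs *:%R g glin).
by exists gL.
Qed.

Lemma kernel_hausdorff : hausdorff_space E -> hausdorff_space kernel_tvs.
Proof.
move=> hE x y xy; apply: kernel_val_inj; apply: hE => A B Ax By.
have [z [Az Bz]] := xy _ _ (kernel_val_continuous Ax) (kernel_val_continuous By).
by exists (kernel_val z).
Qed.

End kernel_tvs.

(** * The l1 norm and maps from normed spaces *)

Section l1norm.
Context (K : numFieldType) (I : choiceType) (G : I -> completeNormedModType K).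
Implicit Types (x y : dsum G).

Definition l1norm x : K := \sum_(t \in [set: I]) `|x t|.

Lemma l1norm_seq (s : seq I) x : uniq s ->
  (forall t, x t != 0 -> t \in s) -> l1norm x = \sum_(t <- s) `|x t|.
Proof.
move=> us xs; rewrite /l1norm (fsbigE s)//=.
  by apply: eq_bigl => t; rewrite in_setT.
by move=> t _; apply: contraNeq; rewrite normr_eq0; exact: xs.
Qed.

Lemma l1normD x y : l1norm (x + y) <= l1norm x + l1norm y.
Proof.
have [s us sP] : exists2 s : seq I, uniq s & forall t,
    ([set t | x t != 0] `|` [set t | y t != 0]) t <-> t \in s.
  apply: finite_set_uniq_seq.
  by rewrite finite_setU; split; exact: dsum_finite.
rewrite (l1norm_seq (s := s) (x := x))//; last by move=> t xt; apply/sP; left.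
rewrite (l1norm_seq (s := s) (x := y))//; last by move=> t yt; apply/sP; right.
rewrite (l1norm_seq (s := s))//; last first.
  move=> t; rewrite dsumDE => xyt; apply/sP => /=.
  by have [xt|] := eqVneq (x t) 0; [right; rewrite xt add0r in xyt|left].
rewrite -big_split/=; apply: ler_sum => t _; exact: ler_normD.
Qed.

Lemma l1normZ a x : l1norm (a *: x) = `|a| * l1norm x.
Proof.
have [s us sP] := finite_set_uniq_seq (dsum_finite x).
rewrite (l1norm_seq (s := s))//; last first.
  by move=> t; rewrite dsumZE scaler_eq0 negb_or => /andP[_ xt]; apply/sP.
rewrite (l1norm_seq (s := s))//; last by move=> t xt; apply/sP.
by rewrite mulr_sumr; apply: eq_bigr => t _; rewrite dsumZE normrZ.
Qed.

Lemma le_l1norm x t : `|x t| <= l1norm x.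
Proof.
have [s us sP] := finite_set_uniq_seq (dsum_finite x).
rewrite (@l1norm_seq s)//; last by move=> r xr; apply/sP.
have [->|xt] := eqVneq (x t) 0; first by rewrite normr0 sumr_ge0.
by rewrite (bigD1_seq t)//=; [rewrite lerDl sumr_ge0|apply/sP].
Qed.

Lemma l1norm_eq0 x : l1norm x = 0 -> x = 0.
Proof.
move=> x0; apply: dsumP => t; apply/eqP; rewrite dsum0E -normr_eq0.
by rewrite eq_le normr_ge0 andbT -x0 le_l1norm.
Qed.

Lemma l1norm_in t (v : G t) : l1norm (dsum_in v) = `|v|.
Proof.
rewrite (@l1norm_seq [:: t])//; first by rewrite big_seq1 dsum_inE.
by move=> s /dsum_in_supp ->; rewrite inE.
Qed.

(** The vector space of the direct sum with the l1 norm, whose topology is coarser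
    than that of the direct sum. *)
Definition l1sum : Type := dsum G.

HB.instance Definition _ := GRing.Lmodule.copy l1sum (dsum G).
HB.instance Definition _ :=
  Lmodule_isNormed.Build K l1sum l1normD l1normZ l1norm_eq0.

Lemma l1sum_normE (x : l1sum) : `|x| = l1norm x. Proof. by []. Qed.

Definition dsum_weight_fun (c : I -> K) x t : G t := c t *: x t.

Lemma dsum_weight_finite c x : finite_set [set t | dsum_weight_fun c x t != 0].
Proof.
apply: sub_finite_set (dsum_finite x) => t /=.
by rewrite scaler_eq0 negb_or => /andP[].
Qed.

Definition dsum_weight (c : I -> K) x : l1sum := DSum (dsum_weight_finite c x).

Lemma dsum_weight_is_linear c : linear (dsum_weight c).
Proof.
move=> a x y; apply: dsumP => t; rewrite dsumDE dsumZE /= /dsum_weight_fun.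
by rewrite dsumDE dsumZE scalerDr !scalerA mulrC.
Qed.

HB.instance Definition _ c := GRing.isLinear.Build K (dsum G) l1sum *:%R
  (dsum_weight c) (@dsum_weight_is_linear c).

(** Continuity is tested on the summands, and each summand is only multiplied by
    a scalar, however fast the weights grow. *)
Lemma dsum_weight_continuous c : continuous (dsum_weight c).
Proof.
apply: dsum_initial => t.
have E (v : G t) : dsum_weight c (dsum_in v) = c t *: (dsum_in v : l1sum).
  apply: dsumP => s; rewrite dsumZE -[LHS]/(c s *: dsum_in (E:=G) v s).
  have [->//|/eqP st] := eqVneq s t.
  have ts : t <> s by move=> ts; apply: st.
  by rewrite !dsum_inN// !scaler0.
apply: (@bounded_linear_continuous K (G t) l1sum
  (dsum_weight c \o dsum_inL G t : {linear G t -> l1sum})).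
apply/bounded_funP => r; exists (`|c t| * r) => v vr /=.
by rewrite E normrZ l1sum_normE l1norm_in ler_wpM2l.
Qed.

Lemma dsum_weight1 x : dsum_weight (fun=> 1) x = x.
Proof. by apply: dsumP => t; rewrite /= /dsum_weight_fun scale1r. Qed.

Lemma dsum_l1_continuous : continuous (idfun : dsum G -> l1sum).
Proof.
rewrite (_ : idfun = dsum_weight (fun=> 1)); first exact: dsum_weight_continuous.
by apply/funext => x; rewrite dsum_weight1.
Qed.

Lemma dsum_hausdorff : hausdorff_space (dsum G).
Proof.
move=> x y xy; apply: (@norm_hausdorff _ l1sum x y) => A B Ax By.
have /xy := dsum_l1_continuous Ax; apply; exact: (dsum_l1_continuous By).
Qed.

End l1norm.

Lemma complex_archimedean (R : realType) (M : R[i]) : exists n : nat, ~ n%:R <= M.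
Proof.
exists (Num.bound `|complex.Re M|) => /=.
rewrite -[_%:R](rmorph_nat (real_complex R)) lecE /= => /andP[_].
apply/negP; rewrite -ltNge; apply: le_lt_trans (ler_norm _) _.
by rewrite archi_boundP.
Qed.

Section finite_support.
Context (R : realType) (I : choiceType) (G : I -> completeNormedModType R[i]).

(** If infinitely many coordinates [b n] were in use, at vectors [x n], the
    weights [n * |x n| / |f (x n) (b n)|] would make the continuous map
    [dsum_weight c \o f] stretch [x n] at least by the factor [n], so that it could
    not be bounded. *)
Lemma normed_dsum_finite_support (V : normedModType R[i]) (f : {linear V -> dsum G}) :
  continuous f -> finite_set [set t | exists x, f x t != 0].
Proof.
move=> fc; apply: contrapT => /infinite_set_sequence[b binj /choice[x xP]].
pose idx t := xget 0%N [set n | b n = t].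
have idxE n : idx (b n) = n.
  by apply: binj; apply: (@xgetPex _ 0%N [set k | b k = b n]); exists n.
pose c t := (idx t)%:R * `|x (idx t)| / `|f (x (idx t)) t|.
have gc : continuous (dsum_weight (G:=G) c \o f).
  by move=> y; apply: continuous_comp; [exact: fc|exact: dsum_weight_continuous].
have /linear_bounded_continuous/linear_boundedP/pinfty_ex_gt0[M M0 fM] := gc.
have [n] := complex_archimedean M; apply.
have xn0 : 0 < `|x n|.
  by rewrite normr_gt0; apply: contraNneq (xP n) => ->; rewrite linear0.
rewrite -(ler_pM2r xn0); apply: le_trans (fM (x n)).
apply: le_trans (le_l1norm _ (b n)); rewrite /= /dsum_weight_fun /c idxE.
rewrite normrZ !normrM !normr_id normfV normr_id normr_nat.
by rewrite divfK ?normr_eq0 ?xP.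
Qed.

Lemma dsum_column_finite (f : {linear dsum G -> dsum G}) t : continuous f ->
  finite_set [set s | exists v : G t, f (dsum_in v) s != 0].
Proof.
move=> fc; apply: (@normed_dsum_finite_support (G t)
  (f \o dsum_inL G t : {linear G t -> dsum G})).
move=> v; apply: (@continuous_comp _ _ _ (@dsum_in _ _ G t) f).
  exact: dsum_in_continuous.
exact: fc.
Qed.

End finite_support.

(** * Banach pieces of a direct sum *)

Section dsum_piece.
Context (K : numFieldType) (I : choiceType) (G : I -> completeNormedModType K).
Context (W : tvsType K) (k : {linear dsum G -> W}) (S : set I).

(** The kernel of this map is the space of vectors supported in [S] that are
    killed by [k]. *)
Definition dsum_piece_fun (x : dsum G) : (dsum G * W)%type :=
  (x - dsum_restr S x, k x).

Lemma dsum_piece_fun_is_linear : linear dsum_piece_fun.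
Proof.
move=> a x y; rewrite /dsum_piece_fun !linearP; congr pair.
by rewrite /= [in RHS]scalerDr addrACA.
Qed.

HB.instance Definition _ := GRing.isLinear.Build K (dsum G) (dsum G * W)%type
  *:%R dsum_piece_fun dsum_piece_fun_is_linear.

Definition dsum_piece_eqn : {linear dsum G -> (dsum G * W)%type} :=
  dsum_piece_fun.

Definition dsum_piece : Type := lkernel dsum_piece_eqn.

HB.instance Definition _ := GRing.Lmodule.copy dsum_piece (lkernel dsum_piece_eqn).

Definition dsum_piece_val (x : dsum_piece) : dsum G := lkernel_val x.

Lemma dsum_piece_val_is_linear : linear dsum_piece_val. Proof. by []. Qed.

HB.instance Definition _ := GRing.isLinear.Build K dsum_piece (dsum G) *:%R
  dsum_piece_val dsum_piece_val_is_linear.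

Lemma dsum_piece_val_inj : injective dsum_piece_val.
Proof. exact: lkernel_val_inj. Qed.

Lemma dsum_piece_supp (x : dsum_piece) t : dsum_piece_val x t != 0 -> S t.
Proof.
have /(congr1 fst)/subr0_eq := lkernelP x; rewrite -/(dsum_piece_val x) => ->.
by rewrite dsum_restrE; case: ifPn => [/set_mem|_]//; rewrite eqxx.
Qed.

Lemma dsum_piece_ker (x : dsum_piece) : k (dsum_piece_val x) = 0.
Proof. by have /(congr1 snd) := lkernelP x. Qed.

Lemma dsum_piece_ex (x : dsum G) : (forall t, x t != 0 -> S t) -> k x = 0 ->
  {y : dsum_piece | dsum_piece_val y = x}.
Proof.
move=> xS kx; suff hx : dsum_piece_eqn x = 0 by exists (LKernel hx).
by rewrite /= /dsum_piece_fun kx dsum_restr_id// subrr.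
Qed.

Lemma dsum_piece_lift (V : lmodType K) (f : {linear V -> dsum G}) :
  (forall x t, f x t != 0 -> S t) -> (forall x, k (f x) = 0) ->
  {g : {linear V -> dsum_piece} | forall x, dsum_piece_val (g x) = f x}.
Proof.
move=> fS kf; pose g x := sval (dsum_piece_ex (fS x) (kf x)).
have gE x : dsum_piece_val (g x) = f x by rewrite /g; case: dsum_piece_ex.
have glin : linear g.
  by move=> a x y; apply: dsum_piece_val_inj; rewrite gE linearP [RHS]linearP -!gE.
pose gL : {linear V -> dsum_piece} := HB.pack g
  (GRing.isLinear.Build K V dsum_piece *:%R g glin).
by exists gL.
Qed.

Let norm (x : dsum_piece) := l1norm (dsum_piece_val x).

Let normD x y : norm (x + y) <= norm x + norm y.
Proof. by rewrite /norm linearD l1normD. Qed.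

Let normZ a x : norm (a *: x) = `|a| * norm x.
Proof. by rewrite /norm linearZ l1normZ. Qed.

Let norm_eq0 x : norm x = 0 -> x = 0.
Proof. by move=> /l1norm_eq0 x0; apply: dsum_piece_val_inj; rewrite x0 linear0. Qed.

HB.instance Definition _ :=
  Lmodule_isNormed.Build K dsum_piece normD normZ norm_eq0.

Lemma dsum_piece_normE (x : dsum_piece) : `|x| = l1norm (dsum_piece_val x).
Proof. by []. Qed.

Definition dsum_piece_coord t : {linear dsum_piece -> G t} :=
  dsum_coord t \o dsum_piece_val.

Lemma le_dsum_piece_coord t x : `|dsum_piece_coord t x| <= `|x|.
Proof. by rewrite dsum_piece_normE; exact: le_l1norm. Qed.

Lemma dsum_piece_coord_continuous t : continuous (dsum_piece_coord t).
Proof.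
apply: bounded_linear_continuous; apply/bounded_funP => r; exists r => x xr.
exact: le_trans (le_dsum_piece_coord t x) xr.
Qed.

(** Together with [dsum_piece_val_continuous] this says that, for finite [S], the
    l1 norm induces on the piece the topology of the direct sum. *)
Lemma dsum_piece_universal (V : topologicalType) (g : V -> dsum_piece) :
  continuous (dsum_piece_val \o g) -> continuous g.
Proof.
move=> cg x; apply/cvgrPdist_lt => e e0.
have /(_ x) c1 : continuous ((idfun : dsum G -> l1sum G) \o (dsum_piece_val \o g)).
  by move=> y; apply: continuous_comp; [exact: cg|exact: dsum_l1_continuous].
by have /cvgrPdist_lt/(_ e e0) := c1.
Qed.

Hypothesis fS : finite_set S.

Lemma dsum_piece_val_cvg (F : set_system dsum_piece) (l : forall t, G t) :
  Filter F -> (forall t, dsum_piece_coord t @ F --> l t) ->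
  exists2 x : dsum G, dsum_piece_val @ F --> x & forall t, x t != 0 -> S t.
Proof.
move=> FF Fl; have [s us sS] := finite_set_uniq_seq fS.
exists (\sum_(t <- s) dsum_in (l t)).
  rewrite (_ : dsum_piece_val =
      fun y => \sum_(t <- s) dsum_in (dsum_piece_coord t y)); last first.
    by apply/funext => y; apply: dsum_seqE => // t /dsum_piece_supp/sS.
  apply: tvs_cvg_sum => t.
  apply: (@cvg_comp _ _ _ (dsum_piece_coord t) (@dsum_in _ _ G t)) (Fl t) _.
  exact: dsum_in_continuous.
move=> t; rewrite dsum_sumE => xt; apply/sS; apply: contraNT xt => ts.
apply/eqP; rewrite big_seq big1// => r rs; apply: (@dsum_inN _ _ _ r t) => rt.
by move: ts; rewrite -rt rs.
Qed.

Lemma dsum_piece_val_continuous : continuous dsum_piece_val.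
Proof.
have [s us sS] := finite_set_uniq_seq fS.
rewrite (_ : dsum_piece_val =
    fun y => \sum_(t <- s) dsum_in (dsum_piece_coord t y)).
  apply: tvs_continuous_sum => t y; apply: continuous_comp.
    exact: dsum_piece_coord_continuous.
  exact: dsum_in_continuous.
by apply/funext => y; apply: dsum_seqE => // t /dsum_piece_supp/sS.
Qed.

Hypotheses (kc : continuous k) (hW : hausdorff_space W).

(** A Cauchy filter converges in each of the finitely many coordinates, hence in
    the direct sum; the limit stays in the closed subspace [k = 0], and convergence
    in the direct sum implies convergence for the l1 norm. *)
Lemma dsum_piece_complete (F : set_system dsum_piece) :
  ProperFilter F -> cauchy F -> cvg F.
Proof.
move=> FF Fc.
have Fl t : cvg (dsum_piece_coord t @ F).
  apply: cauchy_cvg; apply/cauchy_ballP => e e0.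
  have [[A1 A2] [/= FA1 FA2] A12] := (cauchy_ballP F).2 Fc e e0.
  exists (dsum_piece_coord t @` A1, dsum_piece_coord t @` A2).
    by split; rewrite /= nbhs_filterE; [apply: filterS FA1|apply: filterS FA2] =>
      z Az; exists z.
  move=> [_ _] [/= [y1 Ay1 <-] [y2 Ay2 <-]].
  have := A12 (y1, y2) (conj Ay1 Ay2); rewrite -!ball_normE /=.
  apply: le_lt_trans.
  by have := le_dsum_piece_coord t (y1 - y2); rewrite [dsum_piece_coord t _]linearB.
have [x Fx xS] := dsum_piece_val_cvg _ Fl.
have kx : k x = 0.
  have h1 : (k \o dsum_piece_val) @ F --> k x by apply: cvg_comp Fx _; exact: kc.
  have h2 : (k \o dsum_piece_val) @ F --> (0 : W).
    rewrite (_ : _ \o _ = cst 0); first exact: cvg_cst.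
    by apply/funext => y; exact: dsum_piece_ker.
  exact: cvg_unique h1 h2.
have [y yx] := dsum_piece_ex xS kx.
apply/cvg_ex; exists y; apply/cvgrPdist_lt => e e0.
have Fx1 : (idfun \o dsum_piece_val : _ -> l1sum G) @ F --> (x : l1sum G).
  by apply: cvg_comp Fx _; exact: dsum_l1_continuous.
by have /cvgrPdist_lt/(_ e e0) := Fx1; rewrite -yx.
Qed.

End dsum_piece.

(** * Inverting unipotent triangular operators *)

Section unipotent.
Context (K : numFieldType) (I : choiceType) (E : I -> tvsType K).
Context (n : {linear dsum E -> dsum E}).
Implicit Types (x y : dsum E).

Definition neumann m x : dsum E := \sum_(k < m) iter k n x.

Lemma iter_is_linear k : linear (iter k n).
Proof. by elim: k => [//|k IHk] a x y /=; rewrite IHk linearP. Qed.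

HB.instance Definition _ k := GRing.isLinear.Build K (dsum E) (dsum E) *:%R
  (iter k n) (iter_is_linear k).

Lemma iter_eq0_le m p x : (m <= p)%N -> iter m n x = 0 -> iter p n x = 0.
Proof. by move=> mp x0; rewrite -(subnK mp) iterD x0 linear0. Qed.

Lemma neumann_le m p x : (m <= p)%N -> iter m n x = 0 ->
  neumann p x = neumann m x.
Proof.
move=> mp x0; rewrite /neumann (big_ord_widen p (fun k => iter k n x) mp).
rewrite [RHS]big_mkcond /=; apply: eq_bigr => k _; case: ltnP => // mk.
exact: iter_eq0_le mk x0.
Qed.

Lemma neumann_is_linear m : linear (neumann m).
Proof.
move=> a x y; rewrite /neumann scaler_sumr -big_split/=; apply: eq_bigr => k _.
by rewrite linearP.
Qed.

Lemma neumann_telescope m x : neumann m x - n (neumann m x) = x - iter m n x.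
Proof.
rewrite /neumann linear_sum/=; elim: m => [|m IHm].
  by rewrite !big_ord0 !subrr.
by rewrite !big_ord_recr/= opprD addrACA IHm addrA subrK.
Qed.

Lemma neumannC m x : neumann m (n x) = n (neumann m x).
Proof.
by rewrite /neumann linear_sum/=; apply: eq_bigr => k _; rewrite -iterSr.
Qed.

Hypothesis nil : forall t, exists m, forall v : E t,
  iter m n (dsum_in (E:=E) v) = 0.

Lemma iter_nil x : exists m, iter m n x = 0.
Proof.
apply: (@dsum_ind _ _ _ (fun x => exists m, iter m n x = 0) setT) => //.
- by exists 0%N.
- move=> y z [p yp] [q zq]; exists (maxn p q); rewrite linearD/=.
  by rewrite (iter_eq0_le _ yp) ?leq_maxl// (iter_eq0_le _ zq) ?leq_maxr// addr0.
- by move=> t _ v; have [m mP] := nil t; exists m.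
Qed.

Hypothesis nc : continuous n.

Lemma iter_continuous k : continuous (iter k n).
Proof.
elim: k => [|k IHk] x; first exact: cvg_id.
by apply: (@continuous_comp _ _ _ (iter k n) n); [exact: IHk|exact: nc].
Qed.

(** The sum of all the [iter k n x] is finite for each [x]; on each summand [E t]
    the number of terms is uniform, so that the inverse is continuous there, and
    hence on the whole direct sum. *)
Lemma unipotent_inverse : exists v : {linear dsum E -> dsum E},
  [/\ continuous v, forall x, v x - n (v x) = x & forall x, v (x - n x) = x].
Proof.
have /choice[m mP] := iter_nil.
pose v x := neumann (m x) x.
have vE p x : iter p n x = 0 -> v x = neumann p x.
  move=> px; have [mp|/ltnW pm] := leqP (m x) p.
    by rewrite (neumann_le mp).
  by rewrite /v (neumann_le pm).
have vlin : linear v.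
  move=> a x y; pose p := maxn (m (a *: x + y)) (maxn (m x) (m y)).
  rewrite !(@vE p) ?neumann_is_linear//.
  - by apply: iter_eq0_le (mP y); rewrite /p !leq_max leqnn !orbT.
  - by apply: iter_eq0_le (mP x); rewrite /p !leq_max leqnn !orbT.
  - by apply: iter_eq0_le (mP (a *: x + y)); rewrite /p !leq_max leqnn.
pose vL : {linear dsum E -> dsum E} := HB.pack v
  (GRing.isLinear.Build K (dsum E) (dsum E) *:%R v vlin).
exists vL; split => [|x|x].
- apply: dsum_initial => t; have [p pP] := nil t.
  rewrite (_ : _ \o _ = neumann p \o @dsum_in _ _ E t); last first.
    by apply/funext => w /=; exact: vE.
  move=> w; apply: continuous_comp; first exact: dsum_in_continuous.
  by apply: tvs_continuous_sum => k; exact: iter_continuous.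
- by rewrite /= /v neumann_telescope mP subr0.
- have mx : iter (m x) n (n x) = 0 by rewrite -iterSr iterS mP linear0.
  rewrite linearB /= (vE _ _ (mP x)) (vE _ _ mx) neumannC.
  by rewrite neumann_telescope mP subr0.
Qed.

End unipotent.

Section triangular.
Context (K : numFieldType) (I : choiceType) (E : I -> tvsType K).
Context (J : Type) (lt : J -> J -> Prop) (tau : I -> J).
Hypothesis lt_wf : forall P : J -> Prop,
  (forall j, (forall i, lt i j -> P i) -> P j) -> forall j, P j.

(** By induction on [tau t]: [n] maps [E t] into a finite sum of summands [E r]
    with smaller [tau r], on each of which a power of [n] vanishes. *)
Lemma strictly_triangular_nil (n : {linear dsum E -> dsum E}) :
  (forall t, finite_set [set s | exists v : E t, n (dsum_in (E:=E) v) s != 0]) ->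
  (forall t (v : E t) s, n (dsum_in (E:=E) v) s != 0 -> lt (tau s) (tau t)) ->
  forall t, exists m, forall v : E t, iter m n (dsum_in (E:=E) v) = 0.
Proof.
move=> nfin ntri t.
move: {2}(tau t) (erefl (tau t)) => j; elim/lt_wf : j t => j IHj t tj; subst j.
have [s us sP] := finite_set_uniq_seq (nfin t).
have /choice[m mP] r : exists m, r \in s ->
    forall v : E r, iter m n (dsum_in (E:=E) v) = 0.
  have [|_] := boolP (r \in s); last by exists 0%N.
  move=> /sP/=[v vr]; have [m mP] := IHj _ (ntri _ _ _ vr) r erefl.
  by exists m.
exists (\sum_(r <- s) m r).+1 => v; rewrite iterSr.
rewrite (@dsum_seqE _ _ _ s (n _))//; last by move=> r rv; apply/sP; exists v.
rewrite linear_sum/= big_seq big1// => r rs.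
apply: iter_eq0_le (mP r rs _).
by rewrite (bigD1_seq r)//= leq_addr.
Qed.

End triangular.

(** * Countable layers *)

(** [tau t] is the least index whose closure under [A] contains [t].  The fibre of
    [j] lies in the closure of [j], which is countable, and if [s] is in [A t] then
    [s] belongs to every closed set containing [t]. *)
Lemma countable_layering (T : Type) (A : T -> set T) :
  (forall t, countable (A t)) ->
  exists (J : choiceType) (lt : J -> J -> Prop) (tau : T -> J),
  [/\ forall P : J -> Prop,
        (forall j, (forall i, lt i j -> P i) -> P j) -> forall j, P j,
      forall i j k, lt i j -> lt j k -> lt i k,
      forall i, ~ lt i i,
      forall j, countable (tau @^-1` [set j]) &
      forall t s, A t s -> tau s = tau t \/ lt (tau s) (tau t)].
Proof.
move=> Ac.
pose C t := \bigcup_m iter m (fun S => \bigcup_(s in S) A s) [set t].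
have Ct t : C t t by exists 0%N.
have CA t s r : C t s -> A s r -> C t r.
  by move=> [m _ ms] sr; exists m.+1 => //=; exists s.
have Cc t : countable (C t).
  apply: bigcup_countable => // m _; elim: m => [|m IHm] /=.
    exact: countable1.
  by apply: bigcup_countable => // s _; exact: Ac.
have [le le_wo] := @well_ordering_principle {classic T}.
have minP (S : set T) : S !=set0 -> exists2 z, S z & forall s, S s -> le z s.
  move=> [x Sx]; have [|z [[Sz zle] _]] := le_wo [pred s : {classic T} | `[< S s >]].
    by exists x; apply/asboolP.
  by exists z => [|s Ss]; [exact/asboolP|apply: zle; exact/asboolP].
have chain_le : wo_chain le predT := withinW le_wo.
have le_anti x y : le x y -> le y x -> x = y.
  by move=> xy yx; apply: (wo_chain_antisymmetric chain_le) => //; rewrite xy.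
have le_trans x y z : le x y -> le y z -> le x z.
  move=> xy yz.
  have [|w [->|->|->] wle] := @minP [set w | [\/ w = x, w = y | w = z]].
  - by exists x; constructor 1.
  - by apply: wle; constructor 3.
  - by rewrite (le_anti x y xy)//; apply: wle; constructor 1.
  - by rewrite -(le_anti y z yz)//; apply: wle; constructor 2.
have /choice[tau tauP] (t : T) : exists z, C z t /\ forall s, C s t -> le z s.
  have [|z Cz zle] := minP [set s | C s t]; first by exists t; exact: Ct.
  by exists z.
exists {classic T}, (fun i j => le i j /\ i <> j), tau; split.
- move=> P IHP j; apply: contrapT => nPj.
  have [|z nPz zle] := minP [set s | ~ P s]; first by exists j.
  apply: nPz; apply: IHP => i [iz inz]; apply: contrapT => nPi.
  by apply: inz; apply: le_anti iz _; exact: zle.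
- move=> i j k [ij inj] [jk jnk]; split; first exact: le_trans ij jk.
  by move=> ik; apply: inj; apply: le_anti ij _; rewrite ik.
- by move=> i [].
- move=> j; apply: sub_countable (Cc j); apply: subset_card_le => t /= <-.
  by have [] := tauP t.
- move=> t s ts; have [->|tst] := pselect (tau s = tau t); [by left|right].
  split => //; have [_] := tauP s; apply; apply: CA ts; by have [] := tauP t.
Qed.

(** * Subsums *)

Section dsum_subset.
Context (K : numFieldType) (I : choiceType) (E : I -> tvsType K) (A : set I).
Let EA := fun t : A => E (val t).

Lemma dsum_to_subset_finite (x : dsum E) : finite_set [set t : A | x (val t) != 0].
Proof.
apply: (@finite_preimage _ _ [set t | x t != 0] val) (dsum_finite x).
by move=> u v _ _ /val_inj.
Qed.

Definition dsum_to_subset (x : dsum E) : dsum EA :=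
  DSum (E := EA) (dsum_to_subset_finite x).

Lemma dsum_to_subset_is_linear : linear dsum_to_subset.
Proof. by move=> a x y; apply: dsumP. Qed.

HB.instance Definition _ := GRing.isLinear.Build K (dsum E) (dsum EA) *:%R
  dsum_to_subset dsum_to_subset_is_linear.

Definition dsum_of_subset_fun (y : dsum EA) (t : I) : E t :=
  if pselect (t \in A) is left h then y (exist _ t h) else 0.

Lemma dsum_of_subset_funE (y : dsum EA) (s : A) :
  dsum_of_subset_fun y (val s) = y s.
Proof.
rewrite /dsum_of_subset_fun; case: pselect => [h|/(_ (valP s))//].
case: s h => s /= sA h.
by rewrite (Prop_irrelevance h sA).
Qed.

Lemma dsum_of_subset_fun0 (y : dsum EA) t : ~ A t -> dsum_of_subset_fun y t = 0.
Proof.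
move=> At; rewrite /dsum_of_subset_fun; case: pselect => // h.
by case: At; exact: set_mem.
Qed.

Lemma dsum_of_subset_finite (y : dsum EA) :
  finite_set [set t | dsum_of_subset_fun y t != 0].
Proof.
apply: sub_finite_set (finite_image val (dsum_finite y)) => t /= yt.
have [tA|tA] := pselect (t \in A).
  exists (exist _ t tA) => //=.
  by rewrite -(dsum_of_subset_funE y (exist _ t tA)).
by move: yt; rewrite dsum_of_subset_fun0 ?eqxx// => At; apply: tA; exact: mem_set.
Qed.

Definition dsum_of_subset (y : dsum EA) : dsum E := DSum (dsum_of_subset_finite y).

Lemma dsum_of_subsetE y (s : A) : dsum_of_subset y (val s) = y s.
Proof. exact: dsum_of_subset_funE. Qed.

Lemma dsum_of_subset0 y t : ~ A t -> dsum_of_subset y t = 0.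
Proof. exact: dsum_of_subset_fun0. Qed.

Lemma dsum_of_subset_is_linear : linear dsum_of_subset.
Proof.
move=> a x y; apply: dsumP => t; rewrite dsumDE dsumZE.
have [tA|tA] := pselect (A t).
  rewrite -[t]/(val (exist (fun t => t \in A) t (mem_set tA))).
  by rewrite !dsum_of_subsetE.
by rewrite !dsum_of_subset0// scaler0 addr0.
Qed.

HB.instance Definition _ := GRing.isLinear.Build K (dsum EA) (dsum E) *:%R
  dsum_of_subset dsum_of_subset_is_linear.

Lemma dsum_of_to_subset x :
  dsum_of_subset (dsum_to_subset x) = dsum_restr A x.
Proof.
apply: dsumP => t; rewrite dsum_restrE; case: ifPn => [tA|].
  by rewrite -[t]/(val (exist (fun t => t \in A) t tA)) dsum_of_subsetE.
by rewrite notin_setE => tA; rewrite dsum_of_subset0.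
Qed.

Lemma dsum_to_subset_in (s : A) (v : E (val s)) :
  dsum_to_subset (dsum_in (E:=E) v) = dsum_in (E:=EA) (t:=s) v.
Proof.
apply: dsumP => r; rewrite -[LHS]/(dsum_in (E:=E) v (val r)).
have [->|rs] := eqVneq r s; first by rewrite !dsum_inE.
rewrite !dsum_inN//; apply/eqP; rewrite eq_sym//.
Qed.

Lemma dsum_of_subset_in (s : A) (v : E (val s)) :
  dsum_of_subset (dsum_in (E:=EA) (t:=s) v) = dsum_in (E:=E) v.
Proof.
rewrite -dsum_to_subset_in dsum_of_to_subset dsum_restr_id// => t.
by move=> /dsum_in_supp ->; exact: set_mem (valP s).
Qed.

Lemma dsum_to_subset_continuous : continuous dsum_to_subset.
Proof.
apply: dsum_initial => t; have [tA|tA] := pselect (A t).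
  pose s : A := exist _ t (mem_set tA).
  rewrite (_ : _ \o _ = @dsum_in _ _ EA s);
    first exact: (@dsum_in_continuous _ _ EA s).
  by apply/funext => v; exact: (dsum_to_subset_in (s := s)).
rewrite (_ : _ \o _ = cst 0); first exact: cst_continuous.
apply/funext => v; apply: dsumP => s.
apply: (@dsum_inN _ _ E t (val s)) => ts; apply: tA; rewrite ts.
exact: set_mem (valP s).
Qed.

Lemma dsum_of_subset_continuous : continuous dsum_of_subset.
Proof.
apply: dsum_initial => s.
rewrite (_ : _ \o _ = @dsum_in _ _ E (val s));
  first exact: (@dsum_in_continuous _ _ E (val s)).
by apply/funext => v; exact: dsum_of_subset_in.
Qed.

(** The bundled forms, for use over normed summands as with [dsum_inL]. *)
Definition subset_restr : {linear dsum E -> dsum EA} := dsum_to_subset.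
Definition subset_ext : {linear dsum EA -> dsum E} := dsum_of_subset.

End dsum_subset.

Lemma countable_infinite_superset (T : Type) (D : set T) :
  infinite_set [set: T] -> countable D ->
  exists2 A : set T, D `<=` A & (A #= [set: nat])%card.
Proof.
move=> /infinite_set_sequence[b binj _] Dc.
exists (D `|` range b); first by left.
apply: eq_card_nat.
  rewrite -bigcup2E; apply: bigcup_countable => // -[|[|n]] _ //=.
  exact: sub_countable (card_image_le _ _) _.
apply/infiniteP; rewrite -(card_le_eql (inj_card_eq (f := b) (A := setT) _));
  last exact: in2W.
by apply: subset_card_le; right.
Qed.

(** * Ranges of continuous projections *)

Section range.
Context (R : realType) (I : choiceType) (G : I -> completeNormedModType R[i]).
Context (p : {linear dsum G -> dsum G}).
Hypotheses (pc : continuous p) (pp : forall x, p (p x) = p x).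

Definition range_eqn : {linear dsum G -> dsum G} := idfun \- p.

Lemma range_eqnE x : range_eqn x = x - p x. Proof. by []. Qed.

Definition range_tvs : tvsType R[i] := kernel_tvs range_eqn.
Definition range_val : {linear range_tvs -> dsum G} := kernel_val range_eqn.

Lemma range_valP y : p (range_val y) = range_val y.
Proof. by have /subr0_eq := kernel_valP (h := range_eqn) y. Qed.

Lemma range_eqn_im x : range_eqn (p x) = 0.
Proof. by rewrite range_eqnE pp subrr. Qed.

Definition range_proj : {linear dsum G -> range_tvs} :=
  sval (kernel_lift range_eqn_im).

Lemma range_val_proj x : range_val (range_proj x) = p x.
Proof. exact: (svalP (kernel_lift range_eqn_im)). Qed.

Lemma range_val_inj : injective range_val.
Proof. exact: kernel_val_inj. Qed.

Lemma range_val_continuous : continuous range_val.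
Proof. exact: kernel_val_continuous. Qed.

Lemma range_proj_val y : range_proj (range_val y) = y.
Proof. by apply: range_val_inj; rewrite range_val_proj range_valP. Qed.

Lemma range_proj_continuous : continuous range_proj.
Proof.
apply: kernel_continuous.
by rewrite (_ : _ \o _ = p)//; apply/funext => x; exact: range_val_proj.
Qed.

Context (D : set I).
Hypothesis pD : forall x t, p x t != 0 -> D t.

Lemma range_val_supp y t : range_val y t != 0 -> D t.
Proof. by rewrite -range_valP; exact: pD. Qed.

Lemma range_complemented_subspace (A : set I) : D `<=` A ->
  complemented_subspace range_tvs (dsum (fun t : A => G (val t))).
Proof.
move=> DA.
apply: (@retract_complemented_subspace _ _ _
  (subset_restr G A \o range_val) (range_proj \o subset_ext G A)).
- move=> y; apply: continuous_comp; first exact: range_val_continuous.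
  exact: dsum_to_subset_continuous.
- move=> y; apply: continuous_comp; first exact: dsum_of_subset_continuous.
  exact: range_proj_continuous.
- move=> y /=; rewrite dsum_of_to_subset dsum_restr_id ?range_proj_val// => t.
  by move=> /range_val_supp/DA.
Qed.

Hypothesis Dc : countable D.

Let code : {f : I -> nat | {in D &, injective f}}.
Proof. by apply: cid; exact/countable_injP. Qed.

(* The finite sets exhausting the countable set [D]. *)
Let stage n : set I := [set t | D t /\ (sval code t < n)%N].

Let stage_finite n : finite_set (stage n).
Proof.
have cD : {in stage n &, injective (sval code)}.
  move=> s t /set_mem[Ds _] /set_mem[Dt _]; apply: (svalP code); exact: mem_set.
apply: card_le_finite (finite_II n).
rewrite -(card_le_eql (inj_card_eq cD)).
by apply: subset_card_le => _ [t [_ tn] <-].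
Qed.

Let stage_exhaust (S : set I) : finite_set S -> S `<=` D ->
  exists n, S `<=` stage n.
Proof.
move=> /finite_set_uniq_seq[s us sP] SD.
exists (\sum_(t <- s) (sval code t).+1)%N => t St; split; first exact: SD.
by rewrite (bigD1_seq t) ?leq_addr//; exact/sP.
Qed.

Local Notation piece n := (dsum_piece range_eqn (stage n)).

Let range_eqn_continuous : continuous range_eqn.
Proof.
by apply: tvs_continuousB; [move=> x; exact: cvg_id|exact: pc].
Qed.

Let piece_complete n : forall F : set_system (piece n),
  ProperFilter F -> cauchy F -> cvg F.
Proof.
apply: dsum_piece_complete; [exact: stage_finite|exact: range_eqn_continuous|].
exact: dsum_hausdorff.
Qed.

Let banach n : completeNormedModType R[i] :=
  HB.pack (piece n) (Uniform_isComplete.Build (piece n) (@piece_complete n)).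

(** A linear map [phi] that is continuous on the Banach pieces is continuous:
    [phi = phi \o p] on the range, and on each summand [G t] the map [p] factors
    continuously through one of the pieces, by the finiteness of its columns. *)
Lemma range_LB : LB_space range_tvs.
Proof.
split; first by apply: kernel_hausdorff; exact: dsum_hausdorff.
pose pval n : {linear banach n -> dsum G} := @dsum_piece_val _ _ G _ range_eqn (stage n).
have pval_inj n : injective (pval n) by exact: dsum_piece_val_inj.
have pval_supp n x t : pval n x t != 0 -> stage n t by exact: dsum_piece_supp.
have pval_ker n x : range_eqn (pval n x) = 0 by exact: dsum_piece_ker.
have pvalc n : continuous (pval n) by exact: dsum_piece_val_continuous.
have jP n : {g : {linear banach n -> banach n.+1} |
    forall x, pval n.+1 (g x) = pval n x}.
  apply: (@dsum_piece_lift _ _ G _ range_eqn (stage n.+1) (banach n) (pval n)).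
    by move=> x t /pval_supp[Dt tn]; split=> //; exact: ltnW.
  exact: pval_ker.
have iP n : {g : {linear banach n -> range_tvs} |
    forall x, range_val (g x) = pval n x}.
  exact: (kernel_lift (pval_ker n)).
pose j n := sval (jP n); have jE n x : pval n.+1 (j n x) = pval n x.
  exact: (svalP (jP n)).
pose i n := sval (iP n); have iE n x : range_val (i n x) = pval n x.
  exact: (svalP (iP n)).
have ic n : continuous (i n).
  apply: kernel_continuous.
  rewrite (_ : _ \o _ = pval n); first exact: pvalc.
  by apply/funext => x; exact: iE.
exists banach, j, i; split.
- move=> n; apply: dsum_piece_universal.
  rewrite (_ : _ \o _ = pval n); first exact: pvalc.
  by apply/funext => x; exact: jE.
- by move=> n x; apply: range_val_inj; rewrite !iE jE.
- by move=> n x y xy; apply: pval_inj; rewrite -!iE xy.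
- move=> x; have [n xn] := stage_exhaust (dsum_finite (range_val x)) (@range_val_supp x).
  have [y yx] := dsum_piece_ex (xn : forall t, _) (kernel_valP (h := range_eqn) x).
  by exists n, y => //; apply: range_val_inj; rewrite iE.
split=> // F phi _ phic.
suff phiC : continuous (phi \o range_proj).
  have -> : (phi : range_tvs -> F) = (fun x => (phi \o range_proj) (range_val x)).
    by apply/funext => x /=; rewrite range_proj_val.
  move=> x; apply: (@continuous_comp _ _ _ range_val (phi \o range_proj)).
    exact: range_val_continuous.
  exact: phiC.
apply: dsum_initial => t.
have [n ptn] : exists n, [set s | exists v : G t, p (dsum_in v) s != 0] `<=` stage n.
  by apply: stage_exhaust; [exact: dsum_column_finite|move=> s [v /pD]].
have [|x|g gE] := @dsum_piece_lift _ _ G _ range_eqn (stage n) (G t) (p \o dsum_inL G t).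
- by move=> x s xs; apply: ptn; exists x.
- exact: range_eqn_im.
have gc : continuous (g : G t -> banach n).
  apply: dsum_piece_universal.
  rewrite (_ : _ \o _ = p \o dsum_inL G t); last by apply/funext => x; exact: gE.
  by move=> x; apply: continuous_comp; [exact: dsum_in_continuous|exact: pc].
rewrite (_ : _ \o _ = (phi \o i n) \o (g : G t -> banach n)).
  by move=> x; apply: continuous_comp; [exact: gc|exact: phic].
apply/funext => x /=; congr (phi _); apply: range_val_inj.
by rewrite iE range_val_proj; exact/esym/gE.
Qed.

End range.

(** * Block-triangular projections *)

Section block_triangular.
Context (R : realType) (I : choiceType) (G : I -> completeNormedModType R[i]).
Context (r : {linear dsum G -> dsum G}).
Hypotheses (rc : continuous r) (rr : forall x, r (r x) = r x).
Context (J : choiceType) (lt : J -> J -> Prop) (tau : I -> J).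
Hypotheses (lt_wf : forall P : J -> Prop,
    (forall j, (forall i, lt i j -> P i) -> P j) -> forall j, P j)
  (lt_trans : forall i j k, lt i j -> lt j k -> lt i k)
  (lt_irr : forall i, ~ lt i i)
  (r_tri : forall t (v : G t) s, r (dsum_in v) s != 0 ->
    tau s = tau t \/ lt (tau s) (tau t)).
Implicit Types (x : dsum G).

Let D j : set I := tau @^-1` [set j].
Local Notation proj j := (dsum_restr (D j)).

(** The property [P] stands for a lower set of layers, which [r] preserves. *)
Lemma triangular_supp (P : J -> Prop) x : (forall i j, lt i j -> P j -> P i) ->
  (forall t, x t != 0 -> P (tau t)) -> forall t, r x t != 0 -> P (tau t).
Proof.
move=> Plt xP.
apply: (@dsum_ind _ _ _ (fun x => forall t, r x t != 0 -> P (tau t))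
  [set t | P (tau t)] x) => //.
- by move=> t; rewrite linear0 dsum0E eqxx.
- move=> y z yP zP t; rewrite linearD dsumDE.
  by have [->|/yP//] := eqVneq (r y t) 0; rewrite add0r; exact: zP.
- by move=> t Pt v s /r_tri[->//|]; move/Plt; exact.
Qed.

Lemma proj_supp j x t : proj j x t != 0 -> tau t = j.
Proof. by rewrite dsum_restrE; case: ifPn => [/set_mem|]//; rewrite eqxx. Qed.

Lemma projE x t : proj (tau t) x t = x t.
Proof. by rewrite dsum_restrE mem_set. Qed.

(** What lies strictly below the block [j] is mapped strictly below it, hence does
    not contribute to the coordinates in the block [j]. *)
Lemma triangular_diag j x t : (forall t, x t != 0 -> tau t = j \/ lt (tau t) j) ->
  tau t = j -> r (proj j x) t = r x t.
Proof.
move=> xj tj; apply/eqP; rewrite -subr_eq0 -[X in X == 0]/((r (proj j x) - r x) t).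
rewrite -linearB; apply: contrapT => /negP; move/(@triangular_supp (fun i => lt i j)) => h.
apply: (lt_irr (i := j)); rewrite -{1}tj; apply: h.
  by move=> i k; exact: lt_trans.
move=> s; rewrite dsumBE dsum_restrE; case: ifPn => [_|]; first by rewrite subrr eqxx.
by rewrite notin_setE sub0r oppr_eq0 => + /xj[].
Qed.

Definition block j : {linear dsum G -> dsum G} := proj j \o (r \o proj j).

Lemma blockE j x : block j x = proj j (r (proj j x)). Proof. by []. Qed.

Lemma block_continuous j : continuous (block j).
Proof.
have pc := @dsum_restr_continuous _ _ G (D j).
move=> x; apply: (@continuous_comp _ _ _ (r \o proj j) (proj j)); last exact: pc.
by apply: (@continuous_comp _ _ _ (proj j) r); [exact: pc|exact: rc].
Qed.

Lemma block_supp j x t : block j x t != 0 -> D j t.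
Proof. exact: proj_supp. Qed.

Lemma block_idem j x : block j (block j x) = block j x.
Proof.
have pp (y : dsum G) : proj j (proj j y) = proj j y.
  by apply: dsum_restr_id => t; exact: proj_supp.
(* [r (proj j x)] lives in the layers up to [j], where [triangular_diag] lets
   the middle projection be dropped *)
have le_lt i k : lt i k -> k = j \/ lt k j -> i = j \/ lt i j.
  by move=> ik [<-|kj]; right => //; exact: lt_trans ik kj.
apply: dsumP => t; rewrite !blockE pp !dsum_restrE; case: ifPn => // /set_mem tj.
rewrite triangular_diag ?rr// => s.
by apply: (@triangular_supp (fun i => i = j \/ lt i j)) => // u /proj_supp; left.
Qed.

Definition block_tvs j : tvsType R[i] := range_tvs (block j).
Local Notation C j := (range_proj (block_idem j)).
Local Notation val j := (range_val (block j)).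

Lemma blocks_finite x : finite_set [set j | C j x != 0].
Proof.
apply: sub_finite_set (finite_image tau (dsum_finite x)) => j /= xj.
apply: contrapT => nj; move/eqP: xj; apply; apply: range_val_inj.
rewrite range_val_proj linear0 blockE [proj j x]dsum_restr0 ?linear0// => t xt tj.
by apply: nj; exists t.
Qed.

Definition to_blocks x : dsum block_tvs := DSum (E := block_tvs) (blocks_finite x).

Lemma to_blocksE x j : to_blocks x j = C j x. Proof. by []. Qed.

Lemma to_blocks_is_linear : linear to_blocks.
Proof.
move=> a x y; apply: dsumP => j; rewrite dsumDE dsumZE !to_blocksE; exact: linearP.
Qed.

HB.instance Definition _ := GRing.isLinear.Build R[i] (dsum G) (dsum block_tvs) *:%R
  to_blocks to_blocks_is_linear.

Lemma of_blocks_finite (y : dsum block_tvs) :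
  finite_set [set t | val (tau t) (y (tau t)) t != 0].
Proof.
have := bigcup_finite (dsum_finite y) (fun j _ => dsum_finite (val j (y j))).
apply: sub_finite_set => t /= yt; exists (tau t) => //=.
by apply: contraNneq yt => ->; rewrite linear0 dsum0E.
Qed.

Definition of_blocks (y : dsum block_tvs) : dsum G := DSum (of_blocks_finite y).

Lemma of_blocksE y t : of_blocks y t = val (tau t) (y (tau t)) t. Proof. by []. Qed.

Lemma of_blocks_is_linear : linear of_blocks.
Proof.
move=> a x y; apply: dsumP => t.
exact: (congr1 (fun z : dsum G => z t)
  (linearP (val (tau t)) a (x (tau t)) (y (tau t)))).
Qed.

HB.instance Definition _ := GRing.isLinear.Build R[i] (dsum block_tvs) (dsum G) *:%R
  of_blocks of_blocks_is_linear.

Lemma to_blocks_continuous : continuous to_blocks.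
Proof.
apply: dsum_initial => t.
rewrite (_ : _ \o _ =
    @dsum_in _ _ block_tvs (tau t) \o (C (tau t) \o @dsum_in _ _ G t)).
  move=> v; apply: continuous_comp; last exact: dsum_in_continuous.
  apply: continuous_comp; first exact: dsum_in_continuous.
  exact: range_proj_continuous (@block_continuous _) _ _.
apply/funext => v; apply: dsumP => j; rewrite to_blocksE.
have [jt|/eqP jt] := eqVneq (tau t) j; first by subst j; rewrite dsum_inE.
rewrite dsum_inN//; apply: range_val_inj; rewrite range_val_proj linear0 blockE.
by rewrite [proj j (dsum_in _)]dsum_restr0 ?linear0// => s /dsum_in_supp ->.
Qed.

Lemma of_blocks_continuous : continuous of_blocks.
Proof.
apply: dsum_initial => j.
rewrite (_ : _ \o _ = val j); first exact: range_val_continuous.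
apply/funext => v; apply: dsumP => t.
rewrite -[LHS]/(val (tau t) (dsum_in (E:=block_tvs) v (tau t)) t).
have [jt|jt] := pselect (j = tau t); first by subst j; rewrite dsum_inE.
rewrite dsum_inN// linear0 dsum0E; apply/esym/eqP; apply: contra_notT jt.
by move=> /(range_val_supp (@block_supp j)).
Qed.

Lemma of_blocksK : cancel of_blocks to_blocks.
Proof.
move=> y; apply: dsumP => j; rewrite to_blocksE; apply: range_val_inj.
rewrite range_val_proj blockE (_ : proj j (of_blocks y) = val j (y j)).
  rewrite -[RHS]range_valP blockE [proj j (val j _)]dsum_restr_id// => t.
  exact: range_val_supp (@block_supp j) _ _.
apply: dsumP => t; rewrite dsum_restrE; case: ifPn => [/set_mem<-//|].
rewrite notin_setE => tj; apply/esym/eqP; apply: contra_notT tj.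
exact: range_val_supp (@block_supp j) _ _.
Qed.

(** The block diagonal part of [r]; it is factored through the direct sum of the
    ranges of the blocks, which identifies its range with that direct sum. *)
Definition diag : {linear dsum G -> dsum G} := of_blocks \o to_blocks.

Lemma diagE x t : diag x t = r (proj (tau t) x) t.
Proof.
by rewrite of_blocksE to_blocksE range_val_proj blockE projE.
Qed.

Lemma diag_idem x : diag (diag x) = diag x.
Proof. by rewrite /= of_blocksK. Qed.

Lemma diag_continuous : continuous diag.
Proof.
move=> x; apply: (@continuous_comp _ _ _ to_blocks of_blocks).
  exact: to_blocks_continuous.
exact: of_blocks_continuous.
Qed.

Lemma diag_supp (P : J -> Prop) x : (forall i j, lt i j -> P j -> P i) ->
  (forall t, x t != 0 -> P (tau t)) -> forall t, diag x t != 0 -> P (tau t).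
Proof.
move=> Plt xP t; rewrite diagE; apply: triangular_supp => // s.
by rewrite dsum_restrE; case: ifPn => [_ /xP|]//; rewrite eqxx.
Qed.

(** This is [1 - u] for [u = r d + (1 - r) (1 - d)], where [d] is [diag]. *)
Definition offdiag : {linear dsum G -> dsum G} :=
  (r \+ diag) \- ((r \o diag) \+ (r \o diag)).

Lemma offdiagE x : offdiag x = (r x + diag x) - (r (diag x) + r (diag x)).
Proof. by []. Qed.

Lemma offdiag_continuous : continuous offdiag.
Proof.
have rdc : continuous (r \o diag).
  by move=> x; apply: (@continuous_comp _ _ _ diag r); [exact: diag_continuous|exact: rc].
apply: tvs_continuousB; apply: tvs_continuousD => //; exact: diag_continuous.
Qed.

(** On vectors supported in layers up to [tau t], the operators [r] and [d] agree
    in the layer of [t], so [r + d - 2 r d] has there the value [d + d - 2 d d = 0]. *)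
Lemma offdiag_strict t (v : G t) s : offdiag (dsum_in v) s != 0 ->
  lt (tau s) (tau t).
Proof.
pose x : dsum G := dsum_in v; rewrite -/x.
(* the layers up to that of [t] *)
pose P i := i = tau t \/ lt i (tau t).
have Plt i k : lt i k -> P k -> P i.
  by move=> ik [kt|kt]; right; [rewrite -kt|exact: lt_trans ik kt].
have xP u : x u != 0 -> P (tau u) by move=> /dsum_in_supp ->; left.
have dP := diag_supp Plt xP.
have rP := triangular_supp Plt xP.
have rdP := triangular_supp Plt dP.
have diagr (y : dsum G) : (forall u, y u != 0 -> P (tau u)) ->
    tau s = tau t -> diag y s = r y s.
  by move=> yP st; rewrite diagE triangular_diag// st.
move=> xs; have : P (tau s).
  have [x1|/rP//] := eqVneq (r x s) 0.
  have [x2|/dP//] := eqVneq (diag x s) 0.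
  have [x3|/rdP//] := eqVneq (r (diag x) s) 0.
  by move: xs; rewrite offdiagE dsumBE !dsumDE x1 x2 x3 !addr0 subrr eqxx.
case=> // st; exfalso; move/negP: xs; apply; apply/eqP.
rewrite offdiagE dsumBE !dsumDE -!(diagr _ _ st)// diag_idem subrr//.
Qed.

(** Conjugation by [u = 1 - offdiag] turns [r] into [diag], since both [u d] and
    [r u] equal [r d]. *)
Lemma block_diagonalization : exists u v : {linear dsum G -> dsum G},
  [/\ continuous u, continuous v, cancel u v, cancel v u &
      forall x, u (diag x) = r (u x)].
Proof.
have nil := strictly_triangular_nil lt_wf
  (fun t => dsum_column_finite  t offdiag_continuous) offdiag_strict.
have [v [vc uv vu]] := unipotent_inverse nil offdiag_continuous.
exists (idfun \- offdiag), v; split => //.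
- by apply: tvs_continuousB; [move=> x; exact: cvg_id|exact: offdiag_continuous].
move=> x; have key (a b : dsum G) : a - (b + a - (b + b)) = b.
  by rewrite opprB addrC opprD addrA subrK addrK.
(* both sides equal [r (diag x)] *)
rewrite -[LHS]/(diag x - offdiag (diag x)) -[X in r X]/(x - offdiag x).
by rewrite !offdiagE !diag_idem key !(linearB r) !(linearD r) !rr [r x + _]addrC key.
Qed.

End block_triangular.

Arguments of_blocks {R I G} r {J} tau y.

Theorem theorem6p2 (R : realType) (T : Type) (hT : ~ countable [set: T])
    (B : T -> completeNormedModType R[i]) (X : tvsType R[i])
    (hX : complemented_subspace X (dsum B)) :
  exists (J : Type) (F : J -> tvsType R[i]),
    [/\ isomorphic X (dsum F),
        forall j, LB_space (F j) &
        forall j, exists2 Tj : set T, (Tj #= [set: nat])%card &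
          complemented_subspace (F j) (dsum (fun t : Tj => B (val t)))].
Proof.
have [f [g [fc gc fK]]] := complemented_subspace_retract hX.
pose I : choiceType := {classic T}.
pose G : I -> completeNormedModType R[i] := B.
pose r : {linear dsum G -> dsum G} := f \o g.
have rc : continuous r.
  by move=> x; apply: (@continuous_comp _ _ _ g f); [exact: gc|exact: fc].
have rr x : r (r x) = r x by rewrite /= fK.
pose A (t : I) : set I := [set s | exists v : G t, r (dsum_in v) s != 0].
have [|J [lt [tau [lt_wf lt_trans lt_irr tau_fib tauA]]]] := @countable_layering I A.
  by move=> t; apply: finite_set_countable; exact: dsum_column_finite.
have r_tri (t : I) (v : G t) s : r (dsum_in v) s != 0 ->
    tau s = tau t \/ lt (tau s) (tau t).
  by move=> vs; apply: tauA; exists v.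
have [u [v [uc vc uK vK ud]]] := block_diagonalization rc rr lt_wf lt_trans lt_irr r_tri.
have idem := block_idem rr lt_trans lt_irr r_tri.
have bc j : continuous (block r tau j) by exact: block_continuous.
exists J, (block_tvs r tau); split.
- exists (to_blocks rr lt_trans lt_irr r_tri \o (v \o f)),
    (g \o (u \o of_blocks r tau)); split.
  + move=> x /=.
    rewrite -[of_blocks _ _ _]/(diag rr lt_trans lt_irr r_tri (v (f x))).
    by rewrite ud vK /= !fK.
  + move=> y /=; rewrite -[f (g _)]/(r (u (of_blocks r tau y))) -ud uK.
    by rewrite /= !of_blocksK.
  + move=> x; apply: continuous_comp; last exact: to_blocks_continuous.
    by apply: continuous_comp; [exact: fc|exact: vc].
  + move=> y; apply: (@continuous_comp _ _ _ (u \o of_blocks r tau) g); last exact: gc.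
    apply: (@continuous_comp _ _ _ (of_blocks r tau) u); last exact: uc.
    exact: of_blocks_continuous.
- move=> j; apply: (range_LB (bc j) (idem j) (@block_supp _ _ _ _ _ _ j)).
  exact: tau_fib.
- move=> j; have [|Tj sTj cTj] := countable_infinite_superset _ (tau_fib j).
    by apply: contra_not hT; exact: finite_set_countable.
  exists Tj => //.
  by apply: (range_complemented_subspace (bc j) (idem j) (@block_supp _ _ _ _ _ _ j)).
Qed.
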